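(* Let $d\in\mathbb{N}$ and let $f\in\mathbb{R}[x]_{2d}$ be nonnegative on $\mathbb{R}^n$. Then for every $\varepsilon>0$ and every $k_\varepsilon\in\mathbb{N}$ with $$k_\varepsilon\ \ge\ \frac{2(n+1)d(2d-1)}{4\log 2}\left(\varepsilon^{-1}\|f\|_1+1\right)-\frac{n+1+2d}{2},$$ one has $$\theta^{k_\varepsilon}\left(f+\varepsilon\,\theta^{d}\right)\in\Sigma[x]_{k_\varepsilon+d}.$$
   Context: $x=(x_1,\dots,x_n)$; $\mathbb{N}$ contains $0$; $\mathbb{R}[x]_t$ is the set of real polynomials of degree at most $t$; $\Sigma[x]_t$ is the set of sums of squares of real polynomials that have degree at most $2t$. $\theta(x):=1+\|x\|_2^2=1+x_1^2+\dots+x_n^2$. For $h=\sum_\alpha h_\alpha x^\alpha\in\mathbb{R}[x]$, $\|h\|_1:=\sum_\alpha|h_\alpha|$. $\log$ is the natural logarithm. *)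

(* Defs.v *)
From mathcomp Require Import all_boot all_order all_algebra.
From mathcomp Require Import reals.
From mathcomp Require Import mpoly.
From mathcomp Require exp.

Set Implicit Arguments.
Unset Strict Implicit.
Unset Printing Implicit Defensive.

Import Order.TTheory GRing.Theory Num.Theory.
Local Open Scope ring_scope.

(* [msize p] is the degree plus one, and [msize 0 = 0]: the zero polynomial has
   degree at most [t] for every [t]. *)
Definition deg_le (R : realType) (n t : nat) (p : {mpoly R[n]}) : Prop :=
  (msize p <= t.+1)%N.

Definition theta (R : realType) (n : nat) : {mpoly R[n]} :=
  1 + \sum_(i < n) 'X_i ^+ 2.

Definition norm1 (R : realType) (n : nat) (h : {mpoly R[n]}) : R :=
  \sum_(m <- msupp h) `|h@_m|.

(* The degree bound is [2 * t], and bears on the sum [p]. *)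
Definition sos_le (R : realType) (n t : nat) (p : {mpoly R[n]}) : Prop :=
  (exists qs : seq {mpoly R[n]}, p = \sum_(q <- qs) q ^+ 2) /\
  deg_le (2 * t)%N p.

(* Main.v *)
Require Import Defs.
From mathcomp Require Import all_boot all_order all_algebra.
From mathcomp Require Import reals.
From mathcomp Require Import mpoly.
From mathcomp Require exp.
From HB Require Import structures.
From mathcomp Require Import ssrcomplements sesquilinear spectral complex.
From mathcomp Require Import ring lra zify.
From mathcomp Require sequences.

Set Implicit Arguments.
Unset Strict Implicit.
Unset Printing Implicit Defensive.

Import Order.TTheory GRing.Theory Num.Theory.
Local Open Scope ring_scope.

(** Write [G] for the squared norm in [N = n + 1] variables, [p] for the sum
    of the homogenization of [f] and of [eps *: G ^+ d], and [s = k + d].  The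
    claim is a certificate for [G ^+ k * p], which is then read on the affine
    chart where the extra variable equals 1.

    For a nonnegative form [q] of degree [2 * d], the average of
    [q(a) * (a . x) ^+ (2 * s)] over a standard Gaussian vector [a] is a limit
    of sums of squares of forms in [x].  It is even a finite sum of squares:
    only finitely many moments of [a] matter, and a Gaussian quadrature
    reproduces them with finitely many points and nonnegative weights
    ([gauss_kernel_quadrature]).  On the line, such a quadrature is the
    spectral measure of a truncated Jacobi matrix ([gaussian_quadrature1]).

    It remains to write [G ^+ k * p], up to a positive constant, as such an
    average, that is, to invert the map from [q] to its average.  The inverse
    is an explicit alternating sum of the [G ^+ j * iter j lap p]
    ([kernel_inverse]).  By homogeneity each factor [G(a)] integrates to a
    number ([gauss_kernel_sqnX]); once these numbers are divided out, what is
    averaged against [(a . x) ^+ (2 * s)] is the heat flow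
    [exp (- lap / 2) p], that is, the combination of Hermite polynomials
    attached to [p], and Gaussian integration by parts turns the average into
    a multiple of [p(x) * G(x) ^+ k] ([gauss_kernel_kernel_inverse]).

    Finally [q] has to be nonnegative.  Its term of index 0 is [p], which is
    at least [eps * G ^+ d]; the others are bounded through the coefficients
    of [f], because the Laplacian multiplies the size of a monomial of degree
    [e] by at most [e * (e - 1)].  The bounds add up to a tail of an exponential
    series, and the hypothesis on [k] says that this tail is at most
    [exp (ln 2) - 1 = 1] in units of [eps] ([kernel_inverse_ge0]). *)

(** * A quadrature for the Gaussian measure on the line *)

Lemma expr_diagonalized (F : fieldType) (m : nat) (P : 'M[F]_m.+1) (sp : 'rV[F]_m.+1)
  (j : nat) :
  P \in unitmx ->
  (invmx P *m diag_mx sp *m P) ^+ j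
    = invmx P *m diag_mx (\row_i sp 0 i ^+ j) *m P.
Proof.
move=> Punit; elim: j => [|j IH].
  rewrite expr0 (_ : diag_mx _ = 1%:M) ?mulmx1 ?mulVmx //.
  by apply/matrixP => a b; rewrite !mxE expr0.
rewrite exprS IH -[LHS]/(_ *m _) !mulmxA mulmxK // -(mulmxA (invmx P)).
rewrite mulmx_diag; congr (_ *m diag_mx _ *m _).
by apply/rowP => a; rewrite !mxE exprS.
Qed.

Lemma hermitian_spectral_moments (C : numClosedFieldType) (m : nat)
    (H : 'M[C]_m.+1) :
  H \is hermsymmx ->
  exists w a : 'I_m.+1 -> C,
    [/\ forall i, 0 <= w i, forall i, a i \is Num.real &
        forall j, (H ^+ j) 0 0 = \sum_i w i * a i ^+ j].
Proof.
move=> Hherm; have /orthomx_spectralP Heq := hermitian_normalmx Hherm.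
have Punit := spectral_unit H.
have sp_real := hermitian_spectral_diag_real Hherm.
exists (fun i => (invmx (spectralmx H)) 0 i * (spectralmx H) i 0).
exists (fun i => spectral_diag H 0 i); split=> [i|i|j].
- by rewrite invmx_unitary ?spectral_unitarymx // !mxE mulrC mul_conjC_ge0.
- exact/mxOverP.
have := expr_diagonalized (spectral_diag H) j Punit; rewrite -Heq => ->.
rewrite mxE; apply: eq_bigr => i _.
by rewrite mul_mx_diag !mxE mulrAC.
Qed.

(** The spectral measure of [S] at the first basis vector.  Diagonalization is
    over [R[i]]; the eigenvalues and the weights, which are squared moduli of
    entries of a unitary matrix, are real. *)
Lemma symmetric_spectral_moments (R : rcfType) (m : nat) (S : 'M[R]_m.+1) :
  S^T = S ->
  exists w a : 'I_m.+1 -> R, (forall i, 0 <= w i) /\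
    forall j, (S ^+ j) 0 0 = \sum_i w i * a i ^+ j.
Proof.
move=> Ssym.
have Sherm : map_mx (real_complex R) S \is hermsymmx.
  apply: realsym_hermsym.
    apply/is_hermitianmxP; rewrite expr0 scale1r map_mx_id //.
    by rewrite map_trmx Ssym.
  by apply/mxOverP => i j; rewrite mxE; apply/complex_realP; exists (S i j).
have [w [a [w_ge0 a_real wa]]] := hermitian_spectral_moments Sherm.
exists (fun i => complex.Re (w i)), (fun i => complex.Re (a i)); split=> [i|j] /=.
  by move: (w_ge0 i); rewrite lecE => /andP[].
apply: complexI; rewrite rmorph_sum /=.
transitivity ((map_mx (real_complex R) S ^+ j) 0 0).
  by rewrite -rmorphXn mxE.
rewrite wa; apply: eq_bigr => i _.
by rewrite rmorphM rmorphXn /= (RRe_real (ger0_real (w_ge0 i))) (RRe_real (a_real i)).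
Qed.

Fixpoint gaussian_moment (j : nat) : nat :=
  match j with
  | 0 => 1
  | 1 => 0
  | j'.+2 => j'.+1 * gaussian_moment j'
  end.

Lemma gaussian_momentS (j : nat) :
  gaussian_moment j.+1 = (j * gaussian_moment j.-1)%N.
Proof. by case: j. Qed.

(** The coordinates of [(A + A^T)^j e_0], where [A] is the annihilation
    operator of the harmonic oscillator, [A e_i = sqrt(i) e_(i-1)].  Working with
    all natural indices at once keeps the commutation relation [A A^T - A^T A = 1]
    exact; it fails in the last coordinate of any truncation. *)
Fixpoint oscillator (R : rcfType) (j i : nat) : R :=
  if j is j'.+1 then
    Num.sqrt i.+1%:R * oscillator R j' i.+1 + Num.sqrt i%:R * oscillator R j' i.-1
  else (i == 0)%:R.

Lemma oscillator_band (R : rcfType) (j i : nat) :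
  (j < i)%N -> oscillator R j i = 0.
Proof.
elim: j i => [|j IH] [|i] //= ji.
by rewrite !IH ?mulr0 ?addr0 //; lia.
Qed.

(** Annihilation acts on the vectors [(A + A^T)^j e_0] as the derivative with
    respect to [A + A^T], because it commutes with [A + A^T] up to 1 and kills
    [e_0]. *)
Lemma oscillator_lower (R : rcfType) (j i : nat) :
  Num.sqrt i.+1%:R * oscillator R j i.+1 = j%:R * oscillator R j.-1 i.
Proof.
have sq k : Num.sqrt k%:R * Num.sqrt k%:R = k%:R :> R.
  by rewrite -expr2 sqr_sqrtr ?ler0n.
elim: j i => [|j IH] i; first by rewrite /= mulr0 mul0r.
rewrite [oscillator _ j.+1 _]/= IH mulrDr mulrA sq /=.
case: j IH => [|j] IH.
  by rewrite mul0r mulr0 add0r; case: i => [|i] /=; rewrite ?mulr0.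
have -> : j.+2%:R * oscillator R j.+1 i
  = j.+1%:R * oscillator R j.+1 i + oscillator R j.+1 i by rewrite -natr1; ring.
have -> : j.+1%:R * oscillator R j.+1 i
  = Num.sqrt i.+1%:R * (j.+1%:R * oscillator R j i.+1) + i%:R * oscillator R j.+1 i.
  rewrite [oscillator _ j.+1 i in LHS]/= mulrDr mulrCA; congr (_ + _).
  case: i => [|i]; first by rewrite sqrtr0 !mul0r mulr0.
  by rewrite mulrCA -(IH i) mulrA sq.
by rewrite -natr1; ring.
Qed.

Lemma oscillator_moment (R : rcfType) (j : nat) :
  oscillator R j 0 = (gaussian_moment j)%:R.
Proof.
elim/ltn_ind: j => -[|j] IH //.
rewrite gaussian_momentS natrM -IH; last by case: j {IH} => // j; lia.
by rewrite -oscillator_lower /= sqrtr0 mul0r addr0.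
Qed.

(** The Gaussian moments are the moments at [e_0] of the position operator
    [A + A^T].  Truncating this operator to a matrix of size [D + 1] does not
    change them up to order [D], since the first [D] powers applied to [e_0] do
    not leave the truncated space. *)
Lemma gaussian_quadrature1 (R : rcfType) (D : nat) :
  exists m (w a : 'I_m.+1 -> R), (forall i, 0 <= w i) /\
    forall j, (j <= D)%N -> \sum_i w i * a i ^+ j = (gaussian_moment j)%:R.
Proof.
pose J : 'M[R]_D.+1 := \matrix_(i, k)
  ((k == i.+1 :> nat)%:R * Num.sqrt k%:R + (i == k.+1 :> nat)%:R * Num.sqrt i%:R).
have Jsym : J^T = J by apply/matrixP => i k; rewrite !mxE addrC.
have [w [a [w_ge0 wa]]] := symmetric_spectral_moments Jsym.
exists D, w, a; split=> // j jD; rewrite -wa -oscillator_moment.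
suff -> : forall i : 'I_D.+1, (J ^+ j) i 0 = oscillator R j i by [].
elim: j jD => [|j IH] jD i; first by rewrite expr0 mxE.
rewrite exprS mxE; under eq_bigr => k _ do
  rewrite (IH (ltnW jD)) mxE mulrDl -!mulrA !mulr_natl !mulrb.
rewrite big_split -!big_mkcond /=; congr (_ + _).
  have [iD|iD] := ltnP i.+1 D.+1.
    by rewrite (big_pred1 (Ordinal iD)).
  rewrite big1 => [|k /eqP kE]; last by have := ltn_ord k; lia.
  by rewrite oscillator_band ?mulr0 //; lia.
case: i => -[|i] iD /=; first by rewrite big_pred0_eq sqrtr0 mul0r.
by rewrite (big_pred1 (Ordinal (ltnW iD))).
Qed.

(** * Gaussian averages of polynomials *)

Section Monomials.
Variables (R : comNzRingType) (N : nat).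

Lemma leq_mdeg (m : 'X_{1..N}) (i : 'I_N) : (m i <= mdeg m)%N.
Proof. by rewrite mdegE (bigD1 i) //= leq_addr. Qed.

Lemma mderivXU (i k : 'I_N) : ('X_i : {mpoly R[N]})^`M(k) = (i == k)%:R.
Proof.
rewrite mderivX mnm1E; have [->|] := eqVneq i k; last by rewrite scale0r.
rewrite scale1r; have -> : (U_(k) - U_(k) = 0 :> 'X_{1..N})%MM.
  by apply/mnmP=> l; rewrite mnmBE mnm0E subnn.
by rewrite mpolyX0.
Qed.

Lemma mderiv_mulXU (i k : 'I_N) (p : {mpoly R[N]}) :
  ('X_i * p)^`M(k) = (i == k)%:R * p + 'X_i * p^`M(k).
Proof. by rewrite mderivM mderivXU. Qed.

End Monomials.

(** The expectation of [g] at a standard Gaussian vector, defined through its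
    moments, so that it makes sense over any commutative ring and obeys Stein's
    identity with no restriction on degrees. *)
Definition gauss_mean (R : comNzRingType) (N : nat) (g : {mpoly R[N]}) : R :=
  \sum_(m <- msupp g) g@_m * (\prod_i gaussian_moment (m i))%:R.

Section GaussMean.
Variables (R : comNzRingType) (N : nat).

Lemma gauss_meanE (k : nat) (g : {mpoly R[N]}) : (msize g <= k)%N ->
  gauss_mean g
    = \sum_(m : 'X_{1..N < k}) g@_m * (\prod_i gaussian_moment (m i))%:R.
Proof.
pose I : subFinType _ := 'X_{1..N < k}.
move=> le_gk; rewrite /gauss_mean (big_mksub I) /=; first last.
  by move=> x /msize_mdeg_lt/leq_trans/(_ le_gk).
  by rewrite msupp_uniq.
by rewrite big_rmcond //= => j /memN_msupp_eq0 ->; rewrite mul0r.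
Qed.

Lemma gauss_mean_is_linear : linear_for *%R (@gauss_mean R N).
Proof.
move=> c p q.
pose k := maxn (msize (c *: p + q)) (maxn (msize p) (msize q)).
rewrite !(gauss_meanE (k := k)) ?leq_max ?leqnn ?orbT //.
rewrite mulr_sumr -big_split /=; apply: eq_bigr => m _.
by rewrite mcoeffD mcoeffZ mulrDl mulrA.
Qed.

HB.instance Definition _ :=
  GRing.isLinear.Build R {mpoly R[N]} R _ (@gauss_mean R N) gauss_mean_is_linear.

Lemma gauss_meanX (m : 'X_{1..N}) :
  gauss_mean 'X_[R, m] = (\prod_i gaussian_moment (m i))%:R.
Proof. by rewrite /gauss_mean msuppX big_seq1 mcoeffX eqxx mul1r. Qed.

(** Gaussian integration by parts; on monomials it is the recurrence between
    Gaussian moments. *)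
Lemma gauss_mean_stein (i : 'I_N) (g : {mpoly R[N]}) :
  gauss_mean ('X_i * g) = gauss_mean g^`M(i).
Proof.
elim/mpolyind: g => [|c m g _ _ IH]; first by rewrite mulr0 !raddf0.
rewrite mulrDr -scalerAr !linearP /= IH; congr (_ * _ + _).
rewrite -mpolyXD gauss_meanX mderivX linearZ /= gauss_meanX -natrM; congr (_%:R).
rewrite (bigD1 i) //= [in RHS](bigD1 i) //= mnmDE mnmBE mnm1E eqxx add1n subn1.
rewrite gaussian_momentS mulnA; congr (_ * _)%N.
apply: eq_bigr => k ki; rewrite mnmDE mnmBE mnm1E eq_sym (negPf ki).
by rewrite add0n subn0.
Qed.

End GaussMean.

(** The average over [a] of [g(a) * (a . x) ^+ t].  The recursion expands one
    factor [a . x] at a time, so [x] may have coordinates in any commutative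
    algebra (below, polynomials) while [a] ranges over real coefficients. *)
Fixpoint gauss_kernel (R : comNzRingType) (A : comAlgType R) (N : nat)
    (x : 'I_N -> A) (t : nat) (g : {mpoly R[N]}) : A :=
  if t is t'.+1 then \sum_i x i * gauss_kernel x t' ('X_i * g) else (gauss_mean g)%:A.

Definition lap (R : comNzRingType) (N : nat) (p : {mpoly R[N]}) : {mpoly R[N]} :=
  \sum_i p^`M(i)^`M(i).

Definition sqn (R : comNzRingType) (N : nat) : {mpoly R[N]} :=
  \sum_i 'X_i ^+ 2.

Section GaussKernel.
Variables (R : comNzRingType) (A : comAlgType R) (N : nat) (x : 'I_N -> A).

Lemma gauss_kernel_is_linear (t : nat) : linear (gauss_kernel x t).
Proof.
elim: t => [|t IH] c p q /=; first by rewrite linearP /= scalerDl scalerA.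
rewrite scaler_sumr -big_split /=; apply: eq_bigr => i _.
by rewrite mulrDr -scalerAr IH mulrDr scalerAr.
Qed.

HB.instance Definition _ (t : nat) :=
  GRing.isLinear.Build R {mpoly R[N]} A _ (gauss_kernel x t) (gauss_kernel_is_linear t).

(** Integration by parts again; the second term is the derivative of
    [(a . x) ^+ t] with respect to [a_i]. *)
Lemma gauss_kernel_stein (i : 'I_N) (t : nat) (g : {mpoly R[N]}) :
  gauss_kernel x t ('X_i * g)
    = gauss_kernel x t g^`M(i) + t%:R * x i * gauss_kernel x t.-1 g.
Proof.
elim: t g => [|t IH] g; first by rewrite /= gauss_mean_stein !mul0r addr0.
rewrite [LHS]/=; under eq_bigr => k _ do
  rewrite mulrCA IH mderivM linearD /= !mulrDr.
rewrite !big_split /= addrAC addrC; congr (_ + _).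
rewrite (bigD1 i) //= big1 => [|k ki]; last first.
  by rewrite mderivXU (negPf ki) mul0r linear0 mulr0.
rewrite addr0 mderivXU eqxx mul1r -natr1 !mulrDl mul1r addrC; congr (_ + _).
case: t {IH} => [|t] /=; first by rewrite big1 ?mul0r // => k _; rewrite !mul0r mulr0.
by rewrite mulr_sumr; apply: eq_bigr => k _; ring.
Qed.

End GaussKernel.

(** * The Laplacian on polynomials *)

Section Laplacian.
Variables (R : comNzRingType) (N : nat).
Implicit Types (p g : {mpoly R[N]}) (m : 'X_{1..N}).

Lemma lap_is_linear : linear (@lap R N).
Proof.
move=> c p q; rewrite /lap scaler_sumr -big_split /=.
by apply: eq_bigr => i _; rewrite !linearP.
Qed.

HB.instance Definition _ :=
  GRing.isLinear.Build R {mpoly R[N]} {mpoly R[N]} _ (@lap R N) lap_is_linear.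

Lemma iter_lap_is_linear (j : nat) : linear (iter j (@lap R N)).
Proof. by elim: j => [|j IH] c p q //=; rewrite IH linearP. Qed.

HB.instance Definition _ (j : nat) :=
  GRing.isLinear.Build R {mpoly R[N]} {mpoly R[N]} _ (iter j (@lap R N))
    (iter_lap_is_linear j).

Lemma lap_mulXU (i : 'I_N) p : lap ('X_i * p) = 'X_i * lap p + p^`M(i) *+ 2.
Proof.
rewrite /lap mulr_sumr.
under eq_bigr => k _ do rewrite mderiv_mulXU mderivD mderiv_mulXU.
rewrite big_split big_split /= addrCA addrA addrC; congr (_ + _).
rewrite mulr2n (bigD1 i) //= big1 ?addr0 => [|k ki]; last first.
  by rewrite eq_sym (negPf ki) mul0r.
rewrite eqxx mul1r; congr (_ + _).
rewrite (bigD1 i) //= big1 ?addr0 => [|k ki]; last first.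
  by rewrite eq_sym (negPf ki) mul0r mderiv0.
by rewrite eqxx mul1r.
Qed.

Lemma mderiv_lap (i : 'I_N) p : (lap p)^`M(i) = lap p^`M(i).
Proof.
rewrite /lap linear_sum; apply: eq_bigr => k _ /=.
by rewrite (mderiv_comm k i) (mderiv_comm k i).
Qed.

(** The commutator of the Laplacian with multiplication by ['X_i] is
    [2 d/dX_i], which commutes with the Laplacian. *)
Lemma iter_lap_mulXU (i : 'I_N) (j : nat) p :
  iter j (@lap R N) ('X_i * p)
    = 'X_i * iter j (@lap R N) p + (iter j.-1 (@lap R N) p)^`M(i) *+ (2 * j).
Proof.
elim: j => [|j IH]; first by rewrite /= addr0.
rewrite iterS IH linearD linearMn /= lap_mulXU -addrA; congr (_ + _).
rewrite -mderiv_lap; case: j {IH} => [|j] /=; first by rewrite addr0.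
by rewrite -mulrnDr; congr (_ *+ _); lia.
Qed.

Lemma lapX m :
  lap 'X_[R, m] = \sum_i ((m i) * (m i).-1)%:R *: 'X_[m - U_(i) - U_(i)].
Proof.
apply: eq_bigr => i _.
by rewrite mderivX mderivZ mderivX scalerA natrM mnmBE mnm1E eqxx subn1.
Qed.

Lemma mdegB2 m (i : 'I_N) : (1 < m i)%N ->
  mdeg (m - U_(i) - U_(i))%MM = (mdeg m - 2)%N.
Proof.
move=> mi; have lem : (U_(i) + U_(i) <= m)%MM.
  by apply/mnm_lepP => k; rewrite mnmDE mnm1E; case: eqP => // <-.
rewrite -[in RHS](submK lem).
have -> : (m - (U_(i) + U_(i)) = m - U_(i) - U_(i))%MM.
  by apply/mnmP=> k; rewrite !(mnmBE, mnmDE) subnDA.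
by rewrite !mdegD mdeg1 addnK.
Qed.

Lemma iter_lapX_eq0 (j : nat) m : (mdeg m < 2 * j)%N ->
  iter j (@lap R N) 'X_[m] = 0.
Proof.
elim: j m => [|j IH] m; first by rewrite muln0.
move=> mj; rewrite iterSr lapX linear_sum big1 // => i _ /=.
rewrite linearZ /=; have [mi|mi] := ltnP 1 (m i); last first.
  by case: (m i) mi => [|[|]] // _; rewrite ?muln0 scale0r.
have mdeg_mi := leq_mdeg m i.
by rewrite IH ?scaler0 // mdegB2 //; lia.
Qed.

Lemma lap_homog (e : nat) p : p \is e.-homog -> lap p \is (e - 2).-homog.
Proof.
move=> /dhomogP pe; rewrite [p]mpolyE linear_sum big_seq.
apply: rpred_sum => m /pe me; rewrite linearZ rpredZ //= lapX.
apply: rpred_sum => i _; have [mi|mi] := ltnP 1 (m i); last first.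
  by case: (m i) mi => [|[|]] // _; rewrite ?muln0 scale0r rpred0.
by rewrite rpredZ // dhomogX /= mdegB2 // me.
Qed.

Lemma iter_lap_homog (e j : nat) p :
  p \is e.-homog -> iter j (@lap R N) p \is (e - 2 * j).-homog.
Proof.
elim: j => [|j IH] pe; first by rewrite muln0 subn0.
by rewrite mulnS addnC subnDA; apply/lap_homog/IH.
Qed.

Lemma sqn_homog : sqn R N \is 2.-homog.
Proof.
by apply: rpred_sum => i _; apply: (@dhomogMn _ _ _ 1); rewrite dhomogX /= mdeg1.
Qed.

Lemma euler_homog (e : nat) p : p \is e.-homog ->
  \sum_i 'X_i * p^`M(i) = e%:R *: p.
Proof.
move=> /dhomogP pe; rewrite {2}[p]mpolyE scaler_sumr.
rewrite {1}[p]mpolyE; under eq_bigr => i _ do rewrite linear_sum mulr_sumr.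
rewrite exchange_big /= !big_seq; apply: eq_bigr => m /pe me.
under eq_bigr => i _ do rewrite linearZ -scalerAr /= mderivX -scalerAr scalerA.
rewrite scalerA [RHS](_ : _ = (p@_m * (mdeg m)%:R) *: 'X_[m]); last first.
  by rewrite mulrC -[e]me.
rewrite mdegE natr_sum mulr_sumr scaler_suml.
apply: eq_bigr => i _; have [->|mi] := eqVneq (m i) 0%N; first by rewrite mulr0 !scale0r.
congr (_ *: _); rewrite -mpolyXD; congr 'X_[_].
by rewrite addmC submK // lep1mP.
Qed.

End Laplacian.

(** * Inverting the Gaussian kernel *)

Section GaussKernelIdentities.
Variables (R : comNzRingType) (A : comAlgType R) (N : nat) (x : 'I_N -> A).
Implicit Types (g : {mpoly R[N]}).

(** In polar coordinates: under a Gaussian average, a factor [G] in front of a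
    homogeneous function only contributes a radial moment.  The proof is
    integration by parts followed by Euler's identity. *)
Lemma gauss_kernel_sqn (e t : nat) g : g \is e.-homog ->
  gauss_kernel x t (sqn R N * g) = (N + e + t)%:R *: gauss_kernel x t g.
Proof.
move=> ge; rewrite /sqn mulr_suml linear_sum /=.
under eq_bigr => i _ do
  rewrite expr2 -mulrA gauss_kernel_stein mderiv_mulXU eqxx mul1r linearD /=.
rewrite !big_split /= sumr_const card_ord -linear_sum (euler_homog ge) linearZ /=.
rewrite !natrD !scalerDl scaler_nat; congr (_ + _ + _).
case: t => [|t]; first by rewrite scale0r big1 // => i _; rewrite !mul0r.
under eq_bigr => i _ do rewrite -mulrA.
by rewrite -mulr_sumr scaler_nat mulr_natl.
Qed.

Lemma gauss_kernel_sqnX (e t j : nat) g : g \is e.-homog ->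
  gauss_kernel x t (sqn R N ^+ j * g)
    = (\prod_(l < j) (N + e + 2 * l + t))%:R *: gauss_kernel x t g.
Proof.
move=> ge; elim: j => [|j IH]; first by rewrite big_ord0 mul1r scale1r.
have sge : sqn R N ^+ j * g \is (2 * j + e).-homog.
  by apply: dhomogM => //; apply: dhomogMn; exact: sqn_homog.
rewrite exprS -mulrA (gauss_kernel_sqn _ sge) IH scalerA -natrM.
by rewrite big_ord_recr /= mulnC; congr ((_ * _)%:R *: _); lia.
Qed.

Lemma gauss_kernel1 (k : nat) :
  gauss_kernel x (2 * k) 1
    = (gaussian_moment (2 * k))%:R *: (\sum_i x i ^+ 2) ^+ k.
Proof.
elim: k => [|k IH].
  by rewrite muln0 /= -mpolyX0 gauss_meanX big1 // => i _; rewrite mnm0E.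
rewrite mulnS -[(2 + 2 * k)%N]/(2 * k).+2.
transitivity (\sum_i x i * gauss_kernel x (2 * k).+1 ('X_i * 1)) => //.
under eq_bigr => i _ do
  rewrite gauss_kernel_stein -{1}mpolyC1 mderivC linear0 add0r /= IH
    mulrA [x i * _]mulrCA -expr2 -scalerAr -mulrA.
rewrite -scaler_sumr -mulr_sumr -mulr_suml -exprS.
by rewrite gaussian_momentS natrM [in RHS]mulrC -scalerA !scaler_nat mulr_natl.
Qed.

End GaussKernelIdentities.

(** The coefficients of [exp (- lap / 2)] as a power series in [lap]. *)
Definition heat_coef (R : numFieldType) (j : nat) : R :=
  (-1) ^+ j / (2 ^+ j * j`!%:R).

Lemma heat_coefS (R : numFieldType) (j : nat) :
  heat_coef R j.+1 *+ (2 * j.+1) = - heat_coef R j.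
Proof.
rewrite /heat_coef -[LHS]mulr_natr factS !natrM !exprS.
have h1 : (j.+1%:R : R) != 0 by rewrite pnatr_eq0.
have h2 : (j`!%:R : R) != 0 by rewrite pnatr_eq0 -lt0n fact_gt0.
have h3 : (2 ^+ j : R) != 0 by rewrite expf_neq0 // pnatr_eq0.
by field; rewrite h2 h3 nat1r h1.
Qed.

Section Hermite.
Variables (R : numFieldType) (A : comAlgType R) (N : nat) (x : 'I_N -> A).

(** The heat flow [exp (- lap / 2)] maps a monomial to a product of Hermite
    polynomials, and a Hermite polynomial of degree [e] acts under the Gaussian
    average as a derivative of order [e] on the rest of the integrand, here on
    [(a . x) ^+ t]. *)
Lemma gauss_kernel_hermiteX (J t : nat) (m : 'X_{1..N}) : (mdeg m <= 2 * J)%N ->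
  \sum_(j < J.+1) heat_coef R j *: gauss_kernel x t (iter j (@lap R N) 'X_[m])
    = (t ^_ (mdeg m))%:R
        *: ((\prod_i x i ^+ m i) * gauss_kernel x (t - mdeg m) 1).
Proof.
elim: {m}(mdeg m) {-2}m (erefl (mdeg m)) t => [|e IH] m me t mJ.
  move/eqP: me; rewrite mdeg_eq0 => /eqP ->.
  rewrite mdeg0 ffactn0 scale1r [\prod_(i < N) _]big1 ?mul1r ?subn0 => [|i _];
    last by rewrite mnm0E.
  rewrite big_ord_recl /= big1 ?addr0 => [|j _]; last first.
    by rewrite -iterS iter_lapX_eq0 ?mdeg0 ?linear0 ?scaler0 //; lia.
  by rewrite /heat_coef !expr0 fact0 mulr1 divr1 scale1r mpolyX0.
have [i mi] : exists i, m i != 0%N.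
  apply/existsP; apply: contraPT me; rewrite negb_exists => /forallP m0.
  by rewrite mdegE big1 // => k _; apply/eqP; rewrite -[_ == _]negbK m0.
have mE : m = (U_(i) + (m - U_(i)))%MM by rewrite addmC submK // lep1mP.
set m' := (m - U_(i))%MM in mE.
have m'e : mdeg m' = e by move: me; rewrite mE mdegD mdeg1 add1n => -[].
rewrite mE mpolyXD.
under [LHS]eq_bigr => j _ do
  rewrite iter_lap_mulXU linearD /= gauss_kernel_stein linearMn /=
    !scalerDr -scalerMnr scalerMnl addrAC.
(* The terms without a factor [x i] telescope, by [heat_coefS]. *)
rewrite big_split /= [X in X + _](_ : _ = 0) ?add0r; last first.
  rewrite big_split /= big_ord_recr /= (@iter_lapX_eq0 _ _ J) ?m'e; last lia.
  rewrite mderiv0 linear0 scaler0 addr0 big_ord_recl /= muln0 mulr0n scale0r add0r.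
  rewrite -big_split big1 // => j _; rewrite /= -scalerDl.
  by rewrite /bump add1n heat_coefS subrr scale0r.
under eq_bigr => j _ do rewrite scalerAr.
rewrite -mulr_sumr (IH m' m'e) ?m'e; last lia.
rewrite mdegD mdeg1 m'e add1n ffactnS.
have -> : (t.-1 - e = t - e.+1)%N by lia.
rewrite (bigD1 i) //= [in RHS](bigD1 i) //= mnmDE mnm1E eqxx add1n exprS.
rewrite [X in _ = _ *: (_ * X * _)](eq_bigr (fun k => x k ^+ m' k)); last first.
  by move=> k ki; rewrite mnmDE mnm1E eq_sym (negPf ki).
rewrite natrM [(t%:R * _)%R in RHS]mulrC -scalerA -scalerAr; congr (_ *: _).
by rewrite scaler_nat -!mulrA mulr_natl.
Qed.

Lemma gauss_kernel_hermite (J t : nat) (p : {mpoly R[N]}) :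
  p \is (2 * J).-homog ->
  \sum_(j < J.+1) heat_coef R j *: gauss_kernel x t (iter j (@lap R N) p)
    = (t ^_ (2 * J))%:R
        *: (mmap (in_alg A) x p * gauss_kernel x (t - 2 * J) 1).
Proof.
move=> /dhomogP pJ; rewrite {1}[p]mpolyE.
under eq_bigr => j _ do rewrite !linear_sum /=.
rewrite exchange_big /= /mmap mulr_suml scaler_sumr !big_seq.
apply: eq_bigr => m /pJ mJ; have {}mJ : mdeg m = (2 * J)%N by [].
under eq_bigr => j _ do rewrite !linearZ /=.
rewrite -scaler_sumr gauss_kernel_hermiteX ?mJ // /mmap1.
by rewrite mulr_algl -scalerAl scalerA mulrC -scalerA.
Qed.

(** The product in the denominator is the factor that [gauss_kernel_sqnX] takes
    out of [sqn ^+ j], so that the averages of the terms are those of the heat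
    flow of [p]. *)
Definition kernel_inverse (d k : nat) (p : {mpoly R[N]}) : {mpoly R[N]} :=
  \sum_(j < d.+1)
    (heat_coef R j
      / (\prod_(l < j) (N + (2 * d - 2 * j) + 2 * l + 2 * (k + d)))%:R)
      *: (sqn R N ^+ j * iter j (@lap R N) p).

Lemma gauss_kernel_kernel_inverse (d k : nat) (p : {mpoly R[N]}) :
  p \is (2 * d).-homog ->
  gauss_kernel x (2 * (k + d)) (kernel_inverse d k p)
    = ((2 * (k + d)) ^_ (2 * d) * gaussian_moment (2 * k))%:R
        *: ((\sum_i x i ^+ 2) ^+ k * mmap (in_alg A) x p).
Proof.
move=> pd; rewrite linear_sum /=.
transitivity (\sum_(j < d.+1) heat_coef R j
  *: gauss_kernel x (2 * (k + d)) (iter j (@lap R N) p)).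
  apply: eq_bigr => j _; rewrite linearZ /= (gauss_kernel_sqnX _ _ _ (iter_lap_homog j pd)).
  rewrite scalerA divfK // pnatr_eq0 -lt0n prodn_gt0 // => l.
  by have := ltn_ord j; have := ltn_ord l; lia.
rewrite gauss_kernel_hermite // -mulnBr addnK gauss_kernel1 natrM -scalerA.
by rewrite -scalerAr mulrC.
Qed.

End Hermite.

(** * A quadrature in several variables *)

(** The coordinates of a Gaussian vector are independent, so the product of
    one-dimensional quadratures does the job. *)
Lemma gaussian_quadrature (R : rcfType) (N D : nat) :
  exists (I : finType) (W : I -> R) (a : I -> 'I_N -> R),
    (forall i, 0 <= W i) /\
    forall g : {mpoly R[N]}, (msize g <= D.+1)%N ->
      gauss_mean g = \sum_i W i * g.@[a i].
Proof.
have [m [w [a [w_ge0 wa]]]] := gaussian_quadrature1 R D.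
exists {ffun 'I_N -> 'I_m.+1}, (fun f : {ffun 'I_N -> 'I_m.+1} => \prod_i w (f i)),
  (fun (f : {ffun 'I_N -> 'I_m.+1}) i => a (f i)).
split=> [f|g gD]; first by rewrite prodr_ge0.
under eq_bigr => f _ do rewrite mevalE mulr_sumr.
rewrite exchange_big /gauss_mean !big_seq; apply: eq_bigr => b /= bg.
under [RHS]eq_bigr => f _ do rewrite mulrCA -big_split /=.
rewrite -mulr_sumr -(bigA_distr_bigA (fun i k => w k * a k ^+ b i)) natr_prod /=.
congr (_ * _).
apply: eq_bigr => i _; rewrite wa //.
by rewrite -ltnS (leq_trans _ gD) // (leq_trans _ (msize_mdeg_lt bg)) // ltnS
  leq_mdeg.
Qed.

Lemma msize_mulXU (R : idomainType) (N : nat) (i : 'I_N) (g : {mpoly R[N]}) :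
  (msize ('X_i * g) <= (msize g).+1)%N.
Proof.
have [->|g0] := eqVneq g 0; first by rewrite mulr0 msize0.
by rewrite msizeM // -?msize_poly_eq0 msizeX mdeg1.
Qed.

Lemma gauss_kernel_quadrature (R : rcfType) (A : comAlgType R) (N D : nat) :
  exists (I : finType) (W : I -> R) (a : I -> 'I_N -> R),
    (forall i, 0 <= W i) /\
    forall (x : 'I_N -> A) (t : nat) (g : {mpoly R[N]}), (msize g + t <= D.+1)%N ->
      gauss_kernel x t g
        = \sum_i (W i * g.@[a i]) *: (\sum_j a i j *: x j) ^+ t.
Proof.
have [I [W [a [W_ge0 Wa]]]] := gaussian_quadrature R N D.
exists I, W, a; split=> // x; elim=> [|t IH] g gD.
  rewrite /= Wa ?scaler_suml; last by rewrite addn0 in gD.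
  by apply: eq_bigr => i _; rewrite expr0.
transitivity (\sum_j \sum_i x j *
    ((W i * ('X_j * g).@[a i]) *: (\sum_j a i j *: x j) ^+ t)).
  rewrite /=; apply: eq_bigr => j _; rewrite -mulr_sumr IH //.
  by apply: leq_trans gD; rewrite addnS -addSn leq_add2r msize_mulXU.
rewrite exchange_big; apply: eq_bigr => i _ /=.
rewrite exprS mulr_suml scaler_sumr; apply: eq_bigr => j _.
by rewrite mevalM mevalXU -scalerAl -scalerAr scalerA -mulrA [_ * a i j]mulrC.
Qed.

(** * Estimates *)

Lemma exp_partial_ln2 (R : realType) (d : nat) :
  \sum_(j < d) (exp.ln 2 : R) ^+ j / j`!%:R <= 2.
Proof.
have ln2_ge0 : 0 <= exp.ln 2 :> R by apply: exp.ln_ge0; rewrite ler1n.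
rewrite -[leRHS](@exp.lnK R) ?posrE //.
rewrite -(big_mkord xpredT (fun j => (exp.ln 2 : R) ^+ j / j`!%:R)).
apply: (@sequences.nondecreasing_cvgn_le _
  (sequences.series (sequences.exp_coeff (exp.ln (2 : R))))).
  apply/sequences.nondecreasing_seqP => j.
  rewrite /sequences.series /= big_nat_recr //= lerDl.
  exact: sequences.exp_coeff_ge0.
exact: sequences.is_cvg_series_exp_coeff.
Qed.

(** Were [p.[0]] negative, [p - p.[0] / 2] would change sign between 0 and 1 but
    have no root there. *)
Lemma horner_ge0_at0 (R : rcfType) (p : {poly R}) :
  (forall t, t != 0 -> 0 <= p.[t]) -> 0 <= p.[0].
Proof.
move=> p_ge0; rewrite leNgt; apply/negP => p0_lt0.
pose c := - p.[0] / 2.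
have c_gt0 : 0 < c by rewrite divr_gt0 // oppr_gt0.
have [|t _ /rootP] := @poly_ivt R (p + c%:P) 0 1 ler01.
  rewrite !hornerD !hornerC; have := p_ge0 1 (oner_neq0 R).
  by have : c = - p.[0] / 2 by []; move: p0_lt0 c_gt0; lra.
rewrite hornerD hornerC => pt; have [t0|/p_ge0 pt_ge0] := eqVneq t 0; last lra.
by have : c = - p.[0] / 2 by []; rewrite t0 in pt; lra.
Qed.

Section LaplacianBounds.
Variables (R : realFieldType) (N : nat).

(** The Laplacian of a monomial of degree [e] is a nonnegative combination of
    monomials of degree [e - 2], with coefficients of sum at most [e * (e - 1)]. *)
Lemma iter_lapX_bound (y : 'I_N -> R) (rho : R) (j : nat) (m : 'X_{1..N}) :
  0 <= rho -> (forall i, `|y i| <= rho) ->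
  `|(iter j (@lap R N) 'X_[m]).@[y]|
    <= ((mdeg m * (mdeg m).-1) ^ j)%:R * rho ^+ (mdeg m - 2 * j).
Proof.
move=> rho_ge0 y_le; elim: j m => [|j IH] m.
  rewrite muln0 subn0 expn0 mul1r /= mevalX normr_prod mdegE -prodrXr.
  apply: ler_prod => i _; rewrite normr_ge0 normrX /=.
  by apply: lerXn2r => //; rewrite nnegrE.
rewrite iterSr lapX !linear_sum /= (le_trans (ler_norm_sum _ _ _)) //.
have sum_le : (\sum_i m i * (m i).-1 <= mdeg m * (mdeg m).-1)%N.
  rewrite [X in (_ <= X * _)%N]mdegE big_distrl /=; apply: leq_sum => i _.
  by rewrite leq_mul2l; have := leq_mdeg m i; lia.
pose b := ((mdeg m * (mdeg m).-1) ^ j)%:R * rho ^+ (mdeg m - 2 * j.+1).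
apply: (@le_trans _ _ (\sum_i (m i * (m i).-1)%:R * b)); last first.
  rewrite -mulr_suml -natr_sum /b mulrA -natrM expnS.
  by rewrite ler_wpM2r ?exprn_ge0 // ler_nat leq_mul2r sum_le orbT.
apply: ler_sum => i _; rewrite !linearZ /= normrM normr_nat.
have [mi|mi] := ltnP 1 (m i); last first.
  by case: (m i) mi => [|[|]] // _; rewrite ?muln0 !mul0r.
rewrite ler_wpM2l // (le_trans (IH _)) // mdegB2 // /b mulnS subnDA.
rewrite ler_wpM2r ?exprn_ge0 // ler_nat.
have [->|j0] := posnP j; first by rewrite !expn0.
by rewrite leq_exp2r // leq_mul //; lia.
Qed.

End LaplacianBounds.

Section LaplacianSquareNorm.
Variables (R : comNzRingType) (N : nat).

Lemma mderiv_sqn (i : 'I_N) : (sqn R N)^`M(i) = 'X_i *+ 2.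
Proof.
rewrite /sqn linear_sum (bigD1 i) //= big1 ?addr0 => [|k ki].
  by rewrite expr2 mderiv_mulXU mderivXU eqxx mul1r mulr1 mulr2n.
by rewrite expr2 mderiv_mulXU mderivXU (negPf ki) mul0r mulr0 addr0.
Qed.

Lemma mderiv_sqnX (i : 'I_N) (k : nat) :
  (sqn R N ^+ k.+1)^`M(i) = ('X_i * sqn R N ^+ k) *+ (2 * k.+1).
Proof.
elim: k => [|k IH]; first by rewrite expr0 expr1 mulr1 mderiv_sqn.
rewrite exprS mderivM mderiv_sqn IH mulrnAl mulrnAr mulrCA -exprS -mulrnDr.
by congr (_ *+ _); lia.
Qed.

Lemma lap_sqnX (k : nat) :
  lap (sqn R N ^+ k.+1) = (2 * k.+1 * (N + 2 * k))%:R *: sqn R N ^+ k.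
Proof.
rewrite /lap; under eq_bigr => i _ do
  rewrite mderiv_sqnX linearMn /= mderiv_mulXU eqxx mul1r.
have sk : sqn R N ^+ k \is (2 * k).-homog by apply/dhomogMn/sqn_homog.
rewrite sumrMnl big_split /= (euler_homog sk) sumr_const card_ord.
by rewrite -[_ *+ N]scaler_nat -scalerDl -natrD -scaler_nat scalerA -natrM.
Qed.

(** The Laplacian lowers powers of the squared norm by one; the bound on the
    factors is the one for monomials, times the dimension for each Laplacian. *)
Lemma iter_lap_sqnX (d j : nat) : (0 < N)%N ->
  exists2 c : nat, (c <= (N * (2 * d * (2 * d).-1)) ^ j)%N &
    iter j (@lap R N) (sqn R N ^+ d) = c%:R *: sqn R N ^+ (d - j).
Proof.
move=> N0; elim: j => [|j [c c_le cE]]; first by exists 1%N; rewrite ?subn0 ?scale1r.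
case dj: (d - j)%N => [|e].
  exists 0%N; first by [].
  rewrite /= cE dj expr0 linearZ /= -mpolyC1 /lap big1 ?scaler0 ?scale0r // => i _.
  by rewrite mderivC mderiv0.
exists (c * (2 * e.+1 * (N + 2 * e)))%N.
  rewrite expnSr leq_mul // mulnCA leq_mul //; first by lia.
  have : (N + 2 * e <= N * (2 * e).+1)%N by rewrite mulnS leq_add2l leq_pmull.
  by move/leq_trans; apply; rewrite leq_mul //; lia.
rewrite iterS cE dj linearZ /= lap_sqnX scalerA -natrM.
by congr (_ *: _ ^+ _); lia.
Qed.

End LaplacianSquareNorm.

(** * Homogenization *)

Section Homogenization.
Variables (R : comNzRingType) (n : nat).

Definition homogenize_mnm (D : nat) (m : 'X_{1..n}) : 'X_{1..n.+1} :=
  [multinom if unlift ord0 i is Some k then m k else (D - mdeg m)%N | i < n.+1].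

Definition homogenize (D : nat) (f : {mpoly R[n]}) : {mpoly R[n.+1]} :=
  \sum_(m <- msupp f) f@_m *: 'X_[homogenize_mnm D m].

Lemma homogenize_mnm0 (D : nat) (m : 'X_{1..n}) :
  homogenize_mnm D m ord0 = (D - mdeg m)%N.
Proof. by rewrite mnmE unlift_none. Qed.

Lemma homogenize_mnm_lift (D : nat) (m : 'X_{1..n}) (k : 'I_n) :
  homogenize_mnm D m (lift ord0 k) = m k.
Proof. by rewrite mnmE liftK. Qed.

Lemma mdeg_homogenize (D : nat) (m : 'X_{1..n}) :
  (mdeg m <= D)%N -> mdeg (homogenize_mnm D m) = D.
Proof.
move=> mD; rewrite mdegE big_ord_recl homogenize_mnm0.
under eq_bigr => k _ do rewrite homogenize_mnm_lift.
by rewrite -mdegE subnK.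
Qed.

Lemma mdeg_msupp (D : nat) (f : {mpoly R[n]}) (m : 'X_{1..n}) :
  (msize f <= D.+1)%N -> m \in msupp f -> (mdeg m <= D)%N.
Proof. by move=> fD /msize_mdeg_lt mf; rewrite -ltnS (leq_trans mf). Qed.

Lemma homogenize_homog (D : nat) (f : {mpoly R[n]}) :
  (msize f <= D.+1)%N -> homogenize D f \is D.-homog.
Proof.
move=> fD; rewrite /homogenize big_seq; apply: rpred_sum => m mf.
by rewrite rpredZ // dhomogX /= mdeg_homogenize // (mdeg_msupp fD).
Qed.

Lemma meval_homogenize (D : nat) (f : {mpoly R[n]}) (y : 'I_n.+1 -> R) :
  (homogenize D f).@[y] = \sum_(m <- msupp f)
    f@_m * (y ord0 ^+ (D - mdeg m) * \prod_(k < n) y (lift ord0 k) ^+ m k).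
Proof.
rewrite linear_sum; apply: eq_bigr => m _.
rewrite /= linearZ /= mevalX big_ord_recl homogenize_mnm0.
by congr (_ * (_ * _)); apply: eq_bigr => k _; rewrite homogenize_mnm_lift.
Qed.

End Homogenization.

(** Off the hyperplane at infinity [y ord0 = 0] the homogenization is an even
    power of [y ord0] times a value of [f]; at infinity, pass to the limit. *)
Lemma homogenize_ge0 (R : rcfType) (n d : nat) (f : {mpoly R[n]}) :
  (msize f <= (2 * d).+1)%N -> (forall x, 0 <= f.@[x]) ->
  forall y, 0 <= (homogenize (2 * d) f).@[y].
Proof.
move=> fd f_ge0 y; pose v k := y (lift ord0 k).
pose p : {poly R} := \sum_(m <- msupp f)
  (f@_m * \prod_(k < n) v k ^+ m k) *: 'X^(2 * d - mdeg m).
have -> : (homogenize (2 * d) f).@[y] = p.[y ord0].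
  rewrite meval_homogenize horner_sum; apply: eq_bigr => m _.
  by rewrite hornerZ hornerXn -mulrA [X in _ * X]mulrC.
have p_ge0 t : t != 0 -> 0 <= p.[t].
  move=> t0; suff -> : p.[t] = t ^+ (2 * d) * f.@[fun k => v k / t].
    by rewrite mulr_ge0 // exprM exprn_ge0 ?sqr_ge0.
  rewrite horner_sum mevalE mulr_sumr !big_seq; apply: eq_bigr => m mf.
  rewrite hornerZ hornerXn -mulrA [RHS]mulrCA; congr (_ * _).
  under [in RHS]eq_bigr => k _ do rewrite expr_div_n.
  rewrite prodf_div prodrXr -mdegE [RHS]mulrCA; congr (_ * _).
  by rewrite expfB_cond // (negPf t0) add0n (mdeg_msupp fd).
have [->|] := eqVneq (y ord0) 0; [exact: horner_ge0_at0 | exact: p_ge0].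
Qed.

(** The affine chart [(1, X_1, ..., X_n)], on which the homogenization is [f]
    itself and the squared norm is [theta]. *)
Definition affine_point (R : comNzRingType) (n : nat) (i : 'I_n.+1) :
  {mpoly R[n]} := if unlift ord0 i is Some k then 'X_k else 1.

Lemma mmap_homogenize (R : comNzRingType) (n D : nat) (f : {mpoly R[n]}) :
  mmap (in_alg {mpoly R[n]}) (@affine_point R n) (homogenize D f) = f.
Proof.
rewrite raddf_sum [RHS]mpolyE; apply: eq_bigr => m _.
rewrite /= mmapZ mmapX /= mulr_algl; congr (_ *: _).
rewrite /mmap1 big_ord_recl /affine_point unlift_none expr1n mul1r [RHS]mpolyXE_id.
by apply: eq_bigr => k _; rewrite liftK homogenize_mnm_lift.
Qed.

Lemma sum_affine_point_sqr (R : realType) (n : nat) :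
  \sum_i (@affine_point R n i) ^+ 2 = theta R n.
Proof.
rewrite big_ord_recl /affine_point unlift_none expr1n; congr (_ + _).
by apply: eq_bigr => k _; rewrite liftK.
Qed.

Lemma mmap_sqn (R : comNzRingType) (A : comAlgType R) (N : nat) (x : 'I_N -> A) :
  mmap (in_alg A) x (sqn R N) = \sum_i x i ^+ 2.
Proof.
rewrite raddf_sum; apply: eq_bigr => i _.
by rewrite /= rmorphXn /= mmapX mmap1U.
Qed.

Lemma homogenize_lap_bound (R : realType) (n D j : nat) (f : {mpoly R[n]})
    (y : 'I_n.+1 -> R) (rho : R) :
  (msize f <= D.+1)%N -> 0 <= rho -> (forall i, `|y i| <= rho) ->
  `|(iter j (@lap R n.+1) (homogenize D f)).@[y]|
    <= ((D * D.-1) ^ j)%:R * norm1 f * rho ^+ (D - 2 * j).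
Proof.
move=> fD rho_ge0 y_le; rewrite /homogenize !linear_sum /=.
rewrite (le_trans (ler_norm_sum _ _ _)) // -mulrA mulrCA /norm1 mulr_suml !big_seq.
apply: ler_sum => m mf; rewrite !linearZ normrM ler_wpM2l //.
apply: le_trans (iter_lapX_bound _ _ rho_ge0 y_le) _.
by rewrite mdeg_homogenize // (mdeg_msupp fD).
Qed.

(** * Degree bounds *)

Lemma deg_leM (R : realType) (n a b : nat) (p q : {mpoly R[n]}) :
  deg_le a p -> deg_le b q -> deg_le (a + b) (p * q).
Proof.
rewrite /deg_le; have [->|p0] := eqVneq p 0; first by rewrite mul0r msize0.
have [->|q0] := eqVneq q 0; first by rewrite mulr0 msize0.
move=> pa qb; rewrite msizeM // -ltnS; have := leq_add pa qb.
by case: (msize p + msize q)%N => // s; rewrite addSn addnS.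
Qed.

Lemma deg_leX (R : realType) (n a k : nat) (p : {mpoly R[n]}) :
  deg_le a p -> deg_le (a * k) (p ^+ k).
Proof.
move=> pa; elim: k => [|k IH]; first by rewrite muln0 expr0 /deg_le msize1.
by rewrite exprS mulnS; apply: deg_leM.
Qed.

Lemma deg_le_theta (R : realType) (n : nat) : deg_le 2 (theta R n).
Proof.
rewrite /deg_le (leq_trans (msizeD_le _ _)) // geq_max msize1 /=.
rewrite (leq_trans (mmeasure_sum _ _ _ _)) //; apply/bigmax_leqP => i _.
by rewrite expr2 -mpolyXD msizeX mdegD !mdeg1.
Qed.

Lemma deg_leD (R : realType) (n a : nat) (p q : {mpoly R[n]}) :
  deg_le a p -> deg_le a q -> deg_le a (p + q).
Proof.
by rewrite /deg_le => pa qa; rewrite (leq_trans (msizeD_le _ _)) // geq_max pa.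
Qed.

(** * Nonnegativity of the averaged form, and the certificate *)

Lemma gaussian_moment_even_gt0 (k : nat) : (0 < gaussian_moment (2 * k))%N.
Proof. by elim: k => // k IH; rewrite mulnS /= muln_gt0. Qed.

(** With [u = M / eps >= 1], replacing [u * t ^+ j] by [(u * t) ^+ j] for
    [j >= 1] only increases the sum, which is then at most the series of
    [exp (ln 2)] without its first term. *)
Lemma exp_tail_bound (R : realType) (t M eps : R) (d : nat) :
  0 <= t -> 0 < eps -> eps <= M -> t * (M / eps) <= exp.ln 2 ->
  \sum_(j < d) t ^+ j.+1 / j.+1`!%:R * M <= eps.
Proof.
move=> t_ge0 eps_gt0 epsM tM.
have u_ge1 : 1 <= M / eps by rewrite ler_pdivlMr ?mul1r.
have tu_ge0 : 0 <= t * (M / eps) by rewrite mulr_ge0 // (le_trans _ u_ge1).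
have le2 := exp_partial_ln2 R d.+1; rewrite big_ord_recl /= fact0 divr1 expr0 in le2.
have {}le2 : \sum_(j < d) (exp.ln 2 : R) ^+ j.+1 / j.+1`!%:R <= 1 by move: le2; lra.
rewrite -[leRHS]mul1r -ler_pdivrMr // mulr_suml; apply: le_trans le2.
apply: ler_sum => j _; rewrite -(mulrA (_ / _)) mulrAC.
rewrite ler_wpM2r ?invr_ge0 ?ler0n //.
apply: (@le_trans _ _ ((t * (M / eps)) ^+ j.+1)).
  rewrite exprMn ler_wpM2l ?exprn_ge0 // exprS ler_peMr ?exprn_ege1 //.
  by rewrite (le_trans _ u_ge1).
by apply: lerXn2r; rewrite ?nnegrE // (le_trans tu_ge0 tM).
Qed.

(** The first quotient in the hypothesis bounds, up to the factorials, the ratio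
    of consecutive terms of [kernel_inverse]: the numerator is the cost of one
    Laplacian, and the denominator bounds from below the product of the new
    factor under [heat_coef] and the new factor under the fraction. *)
Lemma kernel_inverse_ge0 (R : realType) (n d k : nat) (f : {mpoly R[n]}) (eps : R) :
  deg_le (2 * d) f -> (forall x, 0 <= f.@[x]) -> 0 < eps ->
  (n.+1 * (2 * d * (2 * d).-1))%:R / (2 * (n.+1 + 2 * d + 2 * k)%:R)
    * ((norm1 f + eps) / eps) <= exp.ln 2 ->
  forall y, 0 <= (kernel_inverse d k
    (homogenize (2 * d) f + eps *: sqn R n.+1 ^+ d)).@[y].
Proof.
move=> fd f_ge0 eps_gt0.
set K := (n.+1 * _)%N; set E := (n.+1 + 2 * d + 2 * k)%N; set M := norm1 f + eps.
set t := _ / _ => tM y; set p := _ + _.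
have norm1_ge0 : 0 <= norm1 f by apply: sumr_ge0.
pose rho := Num.sqrt (sqn R n.+1).@[y].
have sqnE : (sqn R n.+1).@[y] = \sum_i y i ^+ 2.
  by rewrite linear_sum; apply: eq_bigr => i _; rewrite rmorphXn /= mevalXU.
have sqn_ge0 : 0 <= (sqn R n.+1).@[y] by rewrite sqnE sumr_ge0 // => i _; rewrite sqr_ge0.
have rho_ge0 : 0 <= rho by exact: sqrtr_ge0.
have rho2 : (sqn R n.+1).@[y] = rho ^+ 2 by rewrite sqr_sqrtr.
have y_le i : `|y i| <= rho.
  rewrite -sqrtr_sqr ler_wsqrtr // sqnE (bigD1 i) //= lerDl sumr_ge0 // => l _.
  by rewrite sqr_ge0.
have lap_le j : (j <= d)%N ->
    `|(iter j (@lap R n.+1) p).@[y]| <= (K ^ j)%:R * M * rho ^+ (2 * d - 2 * j).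
  move=> jd; rewrite linearD mevalD (le_trans (ler_normD _ _)) //.
  rewrite /M mulrDr mulrDl lerD //.
    apply: le_trans (homogenize_lap_bound _ fd rho_ge0 y_le) _.
    rewrite -!mulrA ler_wpM2r ?mulr_ge0 ?exprn_ge0 //.
    suff: ((2 * d * (2 * d).-1) ^ j <= K ^ j)%N by rewrite -(ler_nat R).
    have [->|j0] := posnP j; first by rewrite !expn0.
    by rewrite leq_exp2r // leq_pmull.
  have [//|c c_le cE] := @iter_lap_sqnX R n.+1 d j.
  rewrite linearZ /= cE !mevalZ rmorphXn /= rho2 -exprM mulnBr.
  rewrite !normrM normr_nat (ger0_norm (ltW eps_gt0)) normrX (ger0_norm rho_ge0).
  have cK : c%:R <= (K ^ j)%:R :> R by rewrite ler_nat.
  rewrite mulrCA -[leRHS]mulrA ler_wpM2r ?mulr_ge0 ?exprn_ge0 ?(ltW eps_gt0) //.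
have t_ge0 : 0 <= t by rewrite divr_ge0 ?mulr_ge0.
have E_gt0 : 0 < E%:R :> R by rewrite ltr0n.
rewrite /kernel_inverse linear_sum big_ord_recl /=.
have p_ge : eps * rho ^+ (2 * d) <= p.@[y].
  rewrite mevalD mevalZ rmorphXn /= rho2 -exprM lerDr.
  exact: homogenize_ge0.
rewrite mevalZ big_ord0 /heat_coef !expr0 fact0 !mul1r !invr1 !mulr1 mul1r.
have tail : \sum_(j < d) t ^+ j.+1 / j.+1`!%:R * M <= eps.
  by apply: exp_tail_bound => //; rewrite /M lerDr.
set S := \sum_(j < d) _.
suff : `|S| <= eps * rho ^+ (2 * d) by rewrite ler_norml; lra.
apply: le_trans (ler_wpM2r (exprn_ge0 (2 * d) rho_ge0) tail).
rewrite mulr_suml (le_trans (ler_norm_sum _ _ _)) //.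
apply: ler_sum => j _; rewrite mevalZ mevalM rmorphXn /= rho2 -exprM.
rewrite !normrM normrX normrN1 expr1n mul1r !normrX (ger0_norm rho_ge0).
rewrite /bump add1n add0n -iterS; have := ltn_ord j.
move: (nat_of_ord j).+1 => c cd; set P := (\prod_(l < c) _)%N.
have EP : (E ^ c <= P)%N.
  rewrite -[X in (_ ^ X <= _)%N]card_ord -prod_nat_const.
  by apply: leq_prod => l _; rewrite /E; lia.
have P_inv : P%:R^-1 <= (E%:R ^+ c)^-1 :> R.
  rewrite lef_pV2 ?posrE ?exprn_gt0 // -?natrX ?ler_nat ?ltr0n //.
  by rewrite (leq_trans _ EP) // expn_gt0.
have coef_ge0 : 0 <= (2 ^+ c * c`!%:R)^-1 :> R by rewrite invr_ge0 mulr_ge0 ?exprn_ge0.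
rewrite (ger0_norm coef_ge0) ger0_norm ?invr_ge0 //.
have rhoE : rho ^+ (2 * d) = rho ^+ (2 * c) * rho ^+ (2 * d - 2 * c).
  by rewrite -exprD subnKC // leq_mul2l cd.
have tE : t ^+ c / c`!%:R = (2 ^+ c * c`!%:R)^-1 * (E%:R ^+ c)^-1 * K%:R ^+ c.
  by rewrite /t expr_div_n exprMn !invfM; ring.
have M_ge0 : 0 <= M by rewrite addr_ge0 // ltW.
have -> : t ^+ c / c`!%:R * M * rho ^+ (2 * d)
  = (2 ^+ c * c`!%:R)^-1 * (E%:R ^+ c)^-1
     * (rho ^+ (2 * c) * ((K ^ c)%:R * M * rho ^+ (2 * d - 2 * c))).
  by rewrite tE rhoE natrX; ring.
apply: ler_pM.
- by rewrite mulr_ge0 // invr_ge0 ler0n.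
- by rewrite mulr_ge0 ?exprn_ge0.
- by rewrite ler_wpM2l.
- by rewrite ler_wpM2l ?exprn_ge0 ?lap_le.
Qed.

Theorem theorem3p1 (R : realType) (n d : nat) (f : {mpoly R[n]})
  (hdeg : deg_le (2 * d)%N f)
  (hpos : forall x : 'I_n -> R, 0 <= f.@[x])
  (eps : R) (heps : 0 < eps)
  (k : nat)
  (hk : (2 * (n%:R + 1) * d%:R * (2 * d%:R - 1)) / (4 * exp.ln 2)
          * (eps^-1 * norm1 f + 1)
        - (n%:R + 1 + 2 * d%:R) / 2 <= k%:R) :
  sos_le (k + d)%N (theta R n ^+ k * (f + eps *: theta R n ^+ d)).
Proof.
have ln2_gt0 : 0 < exp.ln 2 :> R by apply: exp.ln_gt0; rewrite ltr1n.
split; last first.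
  rewrite mulnDr; apply: deg_leM; first exact/deg_leX/deg_le_theta.
  apply: deg_leD => //; rewrite /deg_le (leq_trans (msizeZ_le _ _)) //.
  exact/deg_leX/deg_le_theta.
pose p := homogenize (2 * d) f + eps *: sqn R n.+1 ^+ d.
pose q := kernel_inverse d k p.
have q_ge0 : forall y, 0 <= q.@[y].
  apply: kernel_inverse_ge0 => //.
  have -> : (norm1 f + eps) / eps = eps^-1 * norm1 f + 1.
    by rewrite mulrDl divff ?gt_eqF // mulrC.
  have -> : (n.+1 * (2 * d * (2 * d).-1))%:R
      = 2 * (n%:R + 1) * d%:R * (2 * d%:R - 1) :> R.
    case: (d) => [|d']; first by rewrite !muln0 mulr0 mul0r.
    have -> : (2 * d'.+1).-1 = (2 * d').+1 by rewrite mulnS.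
    by rewrite !natrM -!natr1 natrM; ring.
  have {}hk := hk; rewrite lerBlDr mulrAC ler_pdivrMr ?mulr_gt0 // in hk.
  rewrite mulrAC ler_pdivrMr ?mulr_gt0 ?ltr0n //; apply: le_trans hk _.
  by rewrite !natrD -natr1 le_eqVlt; apply/orP; left; apply/eqP; field.
have p_homog : p \is (2 * d).-homog.
  by rewrite rpredD ?rpredZ // ?homogenize_homog //; apply/dhomogMn/sqn_homog.
have [I [W [a [W_ge0 Wa]]]] :=
  @gauss_kernel_quadrature R {mpoly R[n]} n.+1 (msize q + 2 * (k + d)).
have mmap_p : mmap (in_alg {mpoly R[n]}) (@affine_point R n) p
    = f + eps *: theta R n ^+ d.
  rewrite /p rmorphD /= mmap_homogenize mmapZ rmorphXn /= mmap_sqn.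
  by rewrite sum_affine_point_sqr mulr_algl.
have := gauss_kernel_kernel_inverse (@affine_point R n) k p_homog.
rewrite Wa // -/q mmap_p sum_affine_point_sqr.
set C := (_ * gaussian_moment _)%N => CE.
have C_neq0 : C%:R != 0 :> R.
  rewrite pnatr_eq0 muln_eq0 negb_or -!lt0n gaussian_moment_even_gt0 andbT.
  by rewrite ffact_gt0 leq_mul2l leq_addl.
exists [seq Num.sqrt (W i * q.@[a i] / C%:R)
  *: (\sum_j a i j *: @affine_point R n j) ^+ (k + d) | i <- enum I].
rewrite big_map big_enum /=.
apply: (scalerI C_neq0); rewrite -CE scaler_sumr; apply: eq_bigr => i _.
rewrite exprZn sqr_sqrtr ?divr_ge0 ?mulr_ge0 //.
by rewrite scalerA mulrCA divff // mulr1 -exprM mulnC.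
Qed.
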